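(* Let $\mu$ be a $\sigma$-finite positive measure on a set $X$, let $1 \le p < \infty$, let $D$ be an invertible multiplication operator on the complex Banach space $L^p(X,\mu)$, and let $A$ be a bounded linear operator on $L^p(X,\mu)$. Then $$\|A\|^2 \le \|D A\| \, \|D^{-1} A\|$$ and $$\|A\|^2 \le \|A D\| \, \|A D^{-1}\|.$$
   Context: $L^p(X,\mu)$ is the complex Banach space, and $\|\cdot\|$ denotes the operator norm on bounded linear operators on $L^p(X,\mu)$. A multiplication operator $D$ on $L^p(X,\mu)$ is an operator of the form $Df = d f$ for all $f \in L^p(X,\mu)$, where $d \in L^\infty(X,\mu)$ is a fixed (complex-valued) function. Invertible means invertible as a bounded linear operator on $L^p(X,\mu)$. *)

(* Defs.v *)
From HB Require Import structures.
From mathcomp Require Import all_boot all_order all_algebra.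
From mathcomp Require Import complex.
From mathcomp Require Import all_classical all_reals all_analysis.
From mathcomp Require Import measurable_realfun hoelder ess_sup_inf.

Set Implicit Arguments.
Unset Strict Implicit.
Unset Printing Implicit Defensive.

Import Order.TTheory GRing.Theory Num.Theory.
Import numFieldNormedType.Exports.

Local Open Scope classical_set_scope.
Local Open Scope ring_scope.
Local Open Scope quotient_scope.

Section complex_functions.
Context d (T : measurableType d) (R : realType).
Implicit Types f g : T -> R[i].

(* Borel measurability for R[i] = R * R: both coordinates are measurable. *)
Definition Cmeasurable f : Prop :=
  measurable_fun [set: T] (@complex.Re R \o f) /\
  measurable_fun [set: T] (@complex.Im R \o f).

Definition Cabs f : T -> R := fun x => ComplexField.Normc.normc (f x).

Definition CLnorm (mu : {measure set T -> \bar R}) (p : \bar R) f : \bar R :=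
  'N[mu]_p[EFin \o Cabs f]%E.

(* For p = +oo, CLnorm is the essential supremum of |f|, so that CLfun mu +oo
   is the set of representatives of L^oo functions. *)
Definition CLfun (mu : {measure set T -> \bar R}) (p : \bar R) f : Prop :=
  Cmeasurable f /\ (CLnorm mu p f < +oo)%E.

Lemma CabsE f x : `|f x| = (Cabs f x)%:C%C.
Proof. by rewrite normc_def /Cabs; case: (f x). Qed.

Lemma measurable_Cabs f : Cmeasurable f -> measurable_fun [set: T] (Cabs f).
Proof.
move=> [mr mi].
have -> : Cabs f = Num.sqrt \o
    (fun x => complex.Re (f x) ^+ 2 + complex.Im (f x) ^+ 2).
  by apply/funext => x; rewrite /Cabs /=; case: (f x).
apply: measurableT_comp.
  exact: (continuous_measurable_fun (@sqrt_continuous R)).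
by apply: measurable_funD; apply: measurable_funX.
Qed.

Lemma Cabs_ge0 f x : 0 <= Cabs f x.
Proof. by rewrite /Cabs; case: (f x) => a b; exact: sqrtr_ge0. Qed.

Lemma CabsZ (a : R[i]) f : Cabs (a *: f) = ComplexField.Normc.normc a \*: Cabs f.
Proof. by apply/funext => x; rewrite /Cabs/= ComplexField.Normc.normcM. Qed.

Lemma CabsD f g x : Cabs (f + g) x <= Cabs f x + Cabs g x.
Proof. exact: le_normcD. Qed.

Lemma Cmeasurable_lin (a : R[i]) f g :
  Cmeasurable f -> Cmeasurable g -> Cmeasurable (a *: f + g).
Proof.
move: a => [a b] [fr fi] [gr gi]; split.
- have -> : @complex.Re R \o ((a +i* b)%C *: f + g) =
     (fun x => a * (@complex.Re R \o f) x - b * (@complex.Im R \o f) x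
               + (@complex.Re R \o g) x).
    by apply/funext => x /=; rewrite !fctE; case: (f x) (g x) => ? ? [].
  by apply: measurable_funD => //; apply: measurable_funB; apply: measurable_funM.
- have -> : @complex.Im R \o ((a +i* b)%C *: f + g) =
     (fun x => a * (@complex.Im R \o f) x + b * (@complex.Re R \o f) x
               + (@complex.Im R \o g) x).
    by apply/funext => x /=; rewrite !fctE; case: (f x) (g x) => ? ? [].
  by apply: measurable_funD => //; apply: measurable_funD; apply: measurable_funM.
Qed.

End complex_functions.

Section CLfun_theory.
Context d (T : measurableType d) (R : realType).
Variables (mu : {measure set T -> \bar R}) (p : \bar R) (p1 : (1 <= p)%E).
Implicit Types f g : T -> R[i].

Lemma measurable_powR_norm (u : T -> R) (r : R) : measurable_fun [set: T] u ->
  measurable_fun [set: T] (fun x => `|(EFin \o u) x| `^ r)%E.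
Proof.
move=> mu_; apply/measurable_EFinP.
by apply: (measurableT_comp (measurable_powR r)); exact: measurableT_comp.
Qed.

Lemma le_Lnorm (u v : T -> R) :
  measurable_fun [set: T] u -> measurable_fun [set: T] v ->
  (forall x, 0 <= u x) -> (forall x, u x <= v x) ->
  ('N[mu]_p[EFin \o u] <= 'N[mu]_p[EFin \o v])%E.
Proof.
move=> mu_ mv u0 uv; rewrite unlock; case: p p1 => [r| |] //= r1.
- have r0 : 0 <= r by rewrite (le_trans ler01).
  apply: gt0_ler_poweR; first by rewrite invr_ge0.
  + by rewrite in_itv/= leey andbT integral_ge0// => x _; rewrite poweR_ge0.
  + by rewrite in_itv/= leey andbT integral_ge0// => x _; rewrite poweR_ge0.
  + apply: ge0_le_integral => //; [exact: measurable_powR_norm..|].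
    move=> x _; rewrite /= lee_fin ge0_ler_powR ?nnegrE//.
    by rewrite !ger0_norm// (le_trans (u0 x)).
- case: ifPn => // _; apply: le_ess_sup; apply: nearW => x /=.
  by rewrite lee_fin !ger0_norm// (le_trans (u0 x)).
Qed.

Lemma CLnorm_ae f g : Cmeasurable f -> Cmeasurable g -> f = g %[ae mu] ->
  CLnorm mu p f = CLnorm mu p g.
Proof.
move=> /measurable_Cabs mf /measurable_Cabs mg fg.
rewrite /CLnorm unlock; case: p p1 => [r| |] //= _.
- congr poweR; apply: ae_eq_integral => //; [exact: measurable_powR_norm..|].
  by apply: filterS fg => x /= /[apply]; rewrite /Cabs => ->.
- case: ifPn => // _; apply: eq_ess_sup.
  by apply: filterS fg => x /= /(_ I); rewrite /Cabs => ->.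
Qed.

Lemma CLfun_Lfun f : CLfun mu p f -> Cabs f \in Lfun mu p.
Proof. by move=> [/measurable_Cabs mf lf]; apply/andP; split; rewrite inE. Qed.

Lemma CLnormZ (a : R[i]) f : CLfun mu p f ->
  CLnorm mu p (a *: f) = ((ComplexField.Normc.normc a)%:E * CLnorm mu p f)%E.
Proof.
move=> /CLfun_Lfun lf.
have a0 : 0 <= ComplexField.Normc.normc a by case: (a) => ? ?; exact: sqrtr_ge0.
rewrite /CLnorm CabsZ; have := LnormZ (Lfun_Sub p1 lf) (ComplexField.Normc.normc a).
by rewrite ger0_norm.
Qed.

Lemma CLnormD f g : Cmeasurable f -> Cmeasurable g ->
  (CLnorm mu p (f + g)%R <= CLnorm mu p f + CLnorm mu p g)%E.
Proof.
move=> mf mg; have mfg := Cmeasurable_lin 1 mf mg; rewrite scale1r in mfg.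
have [mf' mg'] := (measurable_Cabs mf, measurable_Cabs mg).
apply: le_trans (eminkowski mu mf' mg' p1).
apply: le_Lnorm => [|||x]; [exact: measurable_Cabs|exact: measurable_funD| |].
- exact: Cabs_ge0.
- exact: CabsD.
Qed.

Lemma CLfun0 : CLfun mu p (0 : T -> R[i]).
Proof.
split; first by split; exact: measurable_cst.
rewrite /CLnorm (_ : _ \o _ = cst 0%E) ?Lnorm0//.
  by rewrite gt_eqF// (lt_le_trans _ p1).
by apply/funext => x; rewrite /Cabs /= expr0n/= addr0 sqrtr0.
Qed.

Lemma CLfun_lin (a : R[i]) f g :
  CLfun mu p f -> CLfun mu p g -> CLfun mu p (a *: f + g).
Proof.
move=> lf lg; have [[mf ff] [mg fg]] := (lf, lg).
split; first exact: Cmeasurable_lin.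
have maf : Cmeasurable (a *: f).
  by rewrite -[_ *: _]addr0; apply: Cmeasurable_lin => //; case: CLfun0.
apply: (le_lt_trans (CLnormD maf mg)).
rewrite lte_add_pinfty// CLnormZ// lte_mul_pinfty ?lee_fin//.
by case: (a) => ? ?; exact: sqrtr_ge0.
Qed.

End CLfun_theory.

Section Lp_space.
Context d (T : measurableType d) (R : realType).
Variables (mu : {measure set T -> \bar R}) (p : \bar R) (p1 : (1 <= p)%E).

(* The unused argument keeps 1 <= p visible to the inference of the submodule
   structure. *)
Definition CLfun_pred (_ : (1 <= p)%E) : {pred T -> R[i]} :=
  mem [set f | CLfun mu p f].

Lemma CLfun_submod_closed : submod_closed (CLfun_pred p1).
Proof.
split; first by rewrite inE; exact: CLfun0.
by move=> a f g /[!inE] lf lg; exact: CLfun_lin.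
Qed.

HB.instance Definition _ := GRing.isSubmodClosed.Build R[i] (T -> R[i])
  (CLfun_pred p1) CLfun_submod_closed.

Record CLfunType :=
  MkCLfun { CLfun_val :> T -> R[i]; _ : CLfun_val \in CLfun_pred p1 }.

HB.instance Definition _ := [isSub for CLfun_val].
HB.instance Definition _ := [Choice of CLfunType by <:].
HB.instance Definition _ := [SubChoice_isSubLmodule of CLfunType by <:].

Lemma CLfunP (f : CLfunType) : CLfun mu p f.
Proof. by case: f => f /= /[!inE]. Qed.

Definition CLnull : {pred CLfunType} :=
  mem [set f : CLfunType | (f : T -> R[i]) = cst 0 %[ae mu]].

Lemma CLnull_zmod_closed : zmod_closed CLnull.
Proof.
split; first by rewrite inE/=; exact: aeW.
move=> f g /[!inE]/=; apply: filterS2 => x /= fx gx _.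
by rewrite !fctE fx// gx// subr0.
Qed.

HB.instance Definition _ := GRing.isZmodClosed.Build CLfunType CLnull
  CLnull_zmod_closed.

(* L^p: p-integrable functions modulo functions vanishing almost everywhere. *)
Definition Lp : Type := Quotient.quot CLnull.

HB.instance Definition _ := Choice.on Lp.
HB.instance Definition _ := EqQuotient.on Lp.
HB.instance Definition _ := GRing.Zmodule.on Lp.

Definition Lp_fun (f : Lp) : T -> R[i] := repr f.
Coercion Lp_fun : Lp >-> Funclass.

Lemma Lp_funP (f : Lp) : CLfun mu p f.
Proof. exact: CLfunP. Qed.

Lemma Lp_eqP (f g : CLfunType) :
  \pi_Lp f = \pi_Lp g <-> (f : T -> R[i]) = g %[ae mu].
Proof.
split=> [/eqP|fg].
  rewrite -Quotient.idealrBE inE/=; apply: filterS => x + _ => /(_ I)/eqP.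
  by rewrite !fctE subr_eq0 => /eqP.
apply/eqP; rewrite -Quotient.idealrBE inE/=; apply: filterS fg => x + _ => /(_ I).
by rewrite !fctE => ->; rewrite subrr.
Qed.

Lemma Lp_repr (f : CLfunType) : Lp_fun (\pi_Lp f) = f %[ae mu].
Proof. by apply/Lp_eqP; rewrite reprK. Qed.

Lemma Lp_ext (f g : Lp) : f = g %[ae mu] -> f = g.
Proof. by move=> fg; rewrite -[f]reprK -[g]reprK; apply/Lp_eqP. Qed.

Definition Lp_scale (a : R[i]) (f : Lp) : Lp := \pi_Lp (a *: repr f).

Lemma pi_scale a (f : CLfunType) : Lp_scale a (\pi_Lp f) = \pi_Lp (a *: f).
Proof.
apply/Lp_eqP; have := Lp_repr f; apply: filterS => x /= /[apply] fx.
by rewrite !fctE /= -fx.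
Qed.

Fact Lp_scaleA a b f : Lp_scale a (Lp_scale b f) = Lp_scale (a * b) f.
Proof. by rewrite -[f]reprK (pi_scale b) !(pi_scale _ _) scalerA. Qed.

Fact Lp_scale1 : left_id 1 Lp_scale.
Proof. by move=> f; rewrite -[f]reprK !pi_scale scale1r. Qed.

Fact Lp_scaleDr : right_distributive Lp_scale +%R.
Proof.
by move=> a f g; rewrite -[f]reprK -[g]reprK -raddfD !pi_scale -raddfD scalerDr.
Qed.

Fact Lp_scaleDl f : {morph Lp_scale^~ f : a b / a + b}.
Proof. by move=> a b; rewrite -[f]reprK !pi_scale -raddfD scalerDl. Qed.

HB.instance Definition _ := GRing.Zmodule_isLmodule.Build R[i] Lp
  Lp_scaleA Lp_scale1 Lp_scaleDr Lp_scaleDl.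

Lemma Lp_scaleE (a : R[i]) (f : Lp) :
  Lp_fun (a *: f) = (fun x => a * f x) %[ae mu].
Proof. exact: Lp_repr. Qed.

Lemma Lp_addE (f g : Lp) : Lp_fun (f + g) = (fun x => f x + g x) %[ae mu].
Proof.
have := Lp_repr (repr f + repr g).
by rewrite raddfD /= !reprK; apply: filterS => x /= /[apply].
Qed.

Definition Lp_norm (f : Lp) : R := fine (CLnorm mu p f).

Lemma Lp_normE (f : Lp) : (Lp_norm f)%:E = CLnorm mu p f.
Proof.
by rewrite fineK// ge0_fin_numE ?Lnorm_ge0//; case: (Lp_funP f).
Qed.

Lemma CLnorm_pi (f : CLfunType) : CLnorm mu p (Lp_fun (\pi_Lp f)) = CLnorm mu p f.
Proof.
apply: CLnorm_ae => //; last exact: Lp_repr.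
- by case: (Lp_funP (\pi_Lp f)).
- by case: (CLfunP f).
Qed.

Lemma Lp_normD f g : Lp_norm (f + g) <= Lp_norm f + Lp_norm g.
Proof.
rewrite -lee_fin EFinD !Lp_normE.
have -> : f + g = \pi_Lp (repr f + repr g) by rewrite raddfD /= !reprK.
rewrite CLnorm_pi.
by apply: CLnormD => //; [case: (Lp_funP f)|case: (Lp_funP g)].
Qed.

Lemma Lp_normZ (a : R[i]) f :
  Lp_norm (a *: f) = ComplexField.Normc.normc a * Lp_norm f.
Proof.
apply: EFin_inj; rewrite EFinM !Lp_normE CLnorm_pi.
exact: (CLnormZ p1 _ (Lp_funP f)).
Qed.

Lemma Lp_norm_eq0 f : Lp_norm f = 0 -> f = 0.
Proof.
move=> f0; rewrite -[f]reprK -(raddf0 (\pi_Lp : CLfunType -> Lp)); apply/Lp_eqP.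
have mf := measurable_Cabs (Lp_funP f).1.
have := Lp_normE f; rewrite f0 => /esym/Lnorm_eq0_eq0.
move=> /(_ _ (lt_le_trans lte01 p1)); have /measurable_EFinP := mf.
move=> /[swap] /[apply]; apply: filterS => x /= /(_ I)[+ _].
by rewrite /Cabs => /ComplexField.Normc.eq0_normc.
Qed.

(* The norm of a normedModType over R[i] takes its values in R[i]. *)
Let normC (f : Lp) : R[i] := (Lp_norm f)%:C%C.

Fact Lp_normC_D f g : normC (f + g) <= normC f + normC g.
Proof. by rewrite -rmorphD /= lecR Lp_normD. Qed.

Fact Lp_normC_Z (a : R[i]) f : normC (a *: f) = `|a| * normC f.
Proof. by rewrite /normC Lp_normZ rmorphM/=; case: a => a b; rewrite normc_def. Qed.

Fact Lp_normC_eq0 f : normC f = 0 -> f = 0.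
Proof. by move=> [] /Lp_norm_eq0. Qed.

HB.instance Definition _ :=
  Lmodule_isNormed.Build R[i] Lp Lp_normC_D Lp_normC_Z Lp_normC_eq0.

Lemma Lp_normrE (f : Lp) : `|f| = (fine (CLnorm mu p f))%:C%C.
Proof. by []. Qed.

End Lp_space.

Section operators.
Context (R : realType) (V : normedModType R[i]).

Definition bounded_op (A : V -> V) : Prop :=
  exists M : R, forall v, `|A v| <= M%:C%C * `|v|.

(* complex.Re only converts the norm from R[i] to R. The supremum in R is
   meaningful when A is linear and bounded: the set is then bounded above, and
   it contains `|A 0| = 0. *)
Definition opnorm (A : V -> V) : R :=
  sup [set complex.Re `|A v| | v in [set v : V | `|v| <= 1]].

Definition inverse_op (D E : V -> V) : Prop :=
  [/\ bounded_op E, cancel D E & cancel E D].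

End operators.

Definition multiplication_op d (T : measurableType d) (R : realType)
    (mu : {measure set T -> \bar R}) (p : \bar R) (p1 : (1 <= p)%E)
    (D : Lp mu p1 -> Lp mu p1) : Prop :=
  exists2 m : T -> R[i], CLfun mu +oo%E m &
    forall f : Lp mu p1, Lp_fun (D f) = (fun x => m x * f x) %[ae mu].

(* Main.v *)
Require Import Defs.
From mathcomp Require Import all_boot all_order all_algebra.
From mathcomp Require Import complex.
From mathcomp Require Import all_classical all_reals all_analysis.
From mathcomp Require Import measurable_realfun ess_sup_inf.
From mathcomp Require Import ring lra.

(** Both inequalities come from one decomposition of the identity.  Let [D] be
multiplication by [m] and let [t > 0].  Put [h = t / (1 + t^2 |m|^2)], and let
[M], [N] be the multiplications by [h * conj m] and [h * m].  Pointwise,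
[t m (h conj m) + t^-1 m^-1 (h m) = h (t |m|^2 + t^-1) = 1], so
[[
    1 = t D M + t^-1 D^-1 N = t M D + t^-1 N D^-1,
]]
and [|h m| = t |m| / (1 + (t |m|)^2) <= 1/2] makes [M] and [N] of norm at most
[1/2] ([multiplication_op_splits]).  Composing with [A] on either side gives
[[
    |A| <= (t |DA| + t^-1 |D^-1 A|) / 2   and
    |A| <= (t |AD| + t^-1 |A D^-1|) / 2
]]
for every [t > 0], and the infimum over [t] of the right-hand sides is the
geometric mean ([sqr_le_of_weighted_mean]).  What the space L^p contributes is
that multiplication by a function bounded by [c] has norm at most [c]
([Lp_norm_mul_le]). *)

Set Implicit Arguments.
Unset Strict Implicit.
Unset Printing Implicit Defensive.

Import Order.TTheory GRing.Theory Num.Theory.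
Import numFieldNormedType.Exports.

Local Open Scope classical_set_scope.
Local Open Scope ring_scope.

(** * Operator norms and decompositions of the identity *)

(** The converse of the weighted arithmetic-geometric mean inequality: the
optimal weight is [t = x / a].  If [a = 0] the bound tends to 0 as [t] grows,
which forces [x = 0]. *)
Lemma sqr_le_of_weighted_mean (R : realFieldType) (x a b : R) :
  0 <= x -> 0 <= a -> 0 <= b ->
  (forall t, 0 < t -> x <= 2^-1 * (t * a + t^-1 * b)) -> x ^+ 2 <= a * b.
Proof.
move=> x0 a0 b0 H; have [->|xN0] := eqVneq x 0.
  by rewrite expr0n/= mulr_ge0.
have {x0 xN0}xp : 0 < x by rewrite lt0r xN0.
have Ht t : 0 < t -> 2 * x * t <= t ^+ 2 * a + b.
  move=> t0; have := H t t0; rewrite -(ler_pM2r t0) => le.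
  have e : 2^-1 * (t * a + t^-1 * b) * t = 2^-1 * (t ^+ 2 * a + b).
    by field; rewrite gt_eqF.
  by move: le; rewrite e; lra.
have [a00|aN0] := eqVneq a 0.
  (* a weight so large that b / (2 t) < x *)
  have := Ht ((b + 1) / (2 * x)); rewrite divr_gt0 ?mulr_gt0 ?ltr_wpDl//.
  move=> /(_ isT); rewrite a00 mulr0 add0r.
  have -> : 2 * x * ((b + 1) / (2 * x)) = b + 1 by field; rewrite gt_eqF.
  by rewrite gerDl ler10.
have ap : 0 < a by rewrite lt0r aN0.
have := Ht (x / a) (divr_gt0 xp ap); rewrite -(ler_pM2r ap) => le.
have e1 : 2 * x * (x / a) * a = 2 * x ^+ 2 by field.
have e2 : ((x / a) ^+ 2 * a + b) * a = x ^+ 2 + a * b by field.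
by move: le; rewrite e1 e2; lra.
Qed.

Section operator_norm.
Context (R : realType) (V : normedModType R[i]).
Implicit Types (A B C : {linear V -> V}) (v : V).

Lemma normrRe v : `|v| = (complex.Re `|v|)%:C%C.
Proof. by rewrite complex.RRe_real// ger0_real. Qed.

Lemma opnorm_le (A : V -> V) (c : R) :
  (forall v, `|v| <= 1 -> `|A v| <= c%:C%C) -> opnorm A <= c.
Proof.
move=> Ac; apply: ge_sup.
  by exists (complex.Re `|A 0|); exists 0 => //=; rewrite normr0.
by move=> _ [v /= v1 <-]; rewrite -lecR -normrRe; exact: Ac.
Qed.

Lemma opnorm_has_ubound A : bounded_op A ->
  has_ubound [set complex.Re `|A v| | v in [set v : V | `|v| <= 1]].
Proof.
move=> [M AM]; exists `|M| => _ [v /= v1 <-].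
rewrite -lecR -normrRe (le_trans (AM v))//.
apply: (@le_trans _ _ (`|M|%:C%C * `|v|)).
  by rewrite ler_wpM2r// lecR ler_norm.
by rewrite ler_piMr// lecR.
Qed.

Lemma opnormP A v : bounded_op A -> `|A v| <= (opnorm A)%:C%C * `|v|.
Proof.
move=> bA; have [->|v0] := eqVneq v 0; first by rewrite linear0 !normr0 mulr0.
have vN0 : `|v| != 0 by rewrite normr_eq0.
have vp : 0 < `|v| by rewrite normr_gt0.
rewrite -ler_pdivrMr//.
have -> : `|A v| / `|v| = `|A (`|v|^-1 *: v)|.
  by rewrite linearZ normrZ normfV normr_id mulrC.
rewrite (normrRe (A _)) lecR /opnorm; apply: (ub_le_sup (opnorm_has_ubound bA)).
by exists (`|v|^-1 *: v) => //=; rewrite normrZ normfV normr_id mulVf.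
Qed.

Lemma opnorm_ge0 A : bounded_op A -> 0 <= opnorm A.
Proof.
move=> bA; rewrite /opnorm; apply: (ub_le_sup (opnorm_has_ubound bA)).
by exists 0 => /=; rewrite ?linear0 normr0.
Qed.

Lemma bounded_op_comp A B :
  bounded_op A -> bounded_op B -> bounded_op (A \o B).
Proof.
move=> bA bB; exists (opnorm A * opnorm B) => v /=.
rewrite rmorphM/= -mulrA (le_trans (opnormP _ bA))//.
by rewrite ler_wpM2l ?lecR ?opnorm_ge0// opnormP.
Qed.

Lemma opnorm_sqr_le A B C : bounded_op A -> bounded_op B -> bounded_op C ->
  (forall (t : R) v, 0 < t -> `|v| <= 1 -> `|A v| <=
    (2^-1 * (t * opnorm B + t^-1 * opnorm C))%:C%C) ->
  opnorm A ^+ 2 <= opnorm B * opnorm C.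
Proof.
move=> bA bB bC H; apply: sqr_le_of_weighted_mean; rewrite ?opnorm_ge0//.
by move=> t t0; apply: opnorm_le => v v1; exact: H.
Qed.

(** The constant [1/2] is the maximum of [s / (1 + s^2)] over [s >= 0], attained
at [s = 1]; it turns a sum of two terms into an arithmetic mean. *)
Definition half_contraction (M : V -> V) : Prop :=
  forall v, `|M v| <= 2^-1%:C%C * `|v|.

(** Meant for [E] inverse to [D].  The weight [t] rescales [D] to [t D] and [E]
to [t^-1 E], which is what turns an arithmetic mean of norms into a geometric
one.  The factors [M], [N] stand on the left in one identity and on the right
in the other, to serve [D A], [E A] and [A D], [A E] respectively. *)
Definition splits_identity (D E : V -> V) : Prop :=
  forall t : R, 0 < t -> exists M N : V -> V,
    [/\ half_contraction M, half_contraction N,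
        forall v, v = t%:C%C *: M (D v) + t^-1%:C%C *: N (E v) &
        forall v, v = t%:C%C *: D (M v) + t^-1%:C%C *: E (N v)].

Lemma norm_splitD (t b c : R) (x y : V) : 0 < t ->
  `|x| <= (2^-1 * b)%:C%C -> `|y| <= (2^-1 * c)%:C%C ->
  `|t%:C%C *: x + t^-1%:C%C *: y| <= (2^-1 * (t * b + t^-1 * c))%:C%C.
Proof.
move=> t0 xb yc; apply: (le_trans (ler_normD _ _)).
rewrite mulrDr rmorphD/= !normrZ !ger0_norm ?lecR ?invr_ge0 ?(ltW t0)//.
rewrite mulrCA [in leRHS](mulrCA _ t^-1) !(rmorphM _ _ (2^-1 * _))/=.
by rewrite lerD// ler_wpM2l// lecR ?invr_ge0 ltW.
Qed.

(** Insert the decomposition of the identity to the left of [A] for the first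
inequality and to its right for the second; a factor [1/2] comes out of each
term. *)
Lemma opnorm_sqr_le_comp A B C :
  bounded_op A -> bounded_op B -> bounded_op C -> splits_identity B C ->
  opnorm A ^+ 2 <= opnorm (B \o A) * opnorm (C \o A) /\
  opnorm A ^+ 2 <= opnorm (A \o B) * opnorm (A \o C).
Proof.
move=> bA bB bC BC.
have half_le (M : V -> V) (c : R) (v : V) : half_contraction M ->
    `|v| <= c%:C%C -> `|M v| <= (2^-1 * c)%:C%C.
  move=> hM vc; rewrite rmorphM/= (le_trans (hM v))// ler_wpM2l//.
  by rewrite lecR invr_ge0.
have app1 (F : {linear V -> V}) v c : bounded_op F ->
    `|v| <= c%:C%C -> `|F v| <= (c * opnorm F)%:C%C.
  move=> bF vc; rewrite mulrC rmorphM/= (le_trans (opnormP v bF))//.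
  by rewrite ler_wpM2l// lecR opnorm_ge0.
split; apply: opnorm_sqr_le => //; try exact: bounded_op_comp.
- move=> t v t0 v1; have [M [N [hM hN split_id _]]] := BC t t0.
  rewrite (split_id (A v)); apply: norm_splitD => //; apply: half_le => //.
    rewrite -[opnorm _]mul1r.
    exact: (app1 (B \o A)  _ 1 (bounded_op_comp bB bA)).
  rewrite -[opnorm _]mul1r.
  exact: (app1 (C \o A)  _ 1 (bounded_op_comp bC bA)).
- move=> t v t0 v1; have [M [N [hM hN _ split_id]]] := BC t t0.
  rewrite [in leLHS](split_id v) linearD !linearZ/=.
  apply: norm_splitD => //.
    apply: (app1 (A \o B)); first exact: bounded_op_comp.
    by rewrite -[2^-1]mulr1; exact: half_le.
  apply: (app1 (A \o C)); first exact: bounded_op_comp.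
  by rewrite -[2^-1]mulr1; exact: half_le.
Qed.

End operator_norm.

(** * Multiplication operators on L^p *)

Section multiplication.
Context d (T : measurableType d) (R : realType).
Variable (mu : {measure set T -> \bar R}).
Implicit Types f g k : T -> R[i].

Lemma CmeasurableM f g : Cmeasurable f -> Cmeasurable g ->
  Cmeasurable (fun x => f x * g x).
Proof.
move=> [fr fi] [gr gi]; split.
- have -> : @complex.Re R \o (fun x => f x * g x) =
     (fun x => (@complex.Re R \o f) x * (@complex.Re R \o g) x
               - (@complex.Im R \o f) x * (@complex.Im R \o g) x).
    by apply/funext => x /=; case: (f x) (g x) => ? ? [].
  by apply: measurable_funB; apply: measurable_funM.
- have -> : @complex.Im R \o (fun x => f x * g x) =
     (fun x => (@complex.Re R \o f) x * (@complex.Im R \o g) x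
               + (@complex.Im R \o f) x * (@complex.Re R \o g) x).
    by apply/funext => x /=; case: (f x) (g x) => ? ? [].
  by apply: measurable_funD; apply: measurable_funM.
Qed.

Lemma Cmeasurable_real (u : T -> R) :
  measurable_fun [set: T] u -> Cmeasurable (fun x => (u x)%:C%C).
Proof. by split => //; exact: measurable_cst. Qed.

Lemma Cmeasurable_conj f : Cmeasurable f -> Cmeasurable (fun x => (f x)^*%C).
Proof.
move=> [fr fi]; split.
  rewrite (_ : _ \o _ = @complex.Re R \o f)//.
  by apply/funext => x /=; case: (f x).
rewrite (_ : _ \o _ = \- (@complex.Im R \o f)); first exact: measurableT_comp.
by apply/funext => x /=; case: (f x).
Qed.

Lemma CLnorm_le_ae (r : R) f g : 1 <= r -> Cmeasurable f -> Cmeasurable g ->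
  (\forall x \ae mu, Cabs f x <= Cabs g x) ->
  (CLnorm mu r%:E f <= CLnorm mu r%:E g)%E.
Proof.
move=> r1 /measurable_Cabs mf /measurable_Cabs mg fg; rewrite /CLnorm unlock /=.
have r0 : 0 <= r by rewrite (le_trans ler01).
apply: gt0_ler_poweR; first by rewrite invr_ge0.
- by rewrite in_itv/= leey andbT integral_ge0// => x _; rewrite poweR_ge0.
- by rewrite in_itv/= leey andbT integral_ge0// => x _; rewrite poweR_ge0.
- apply: ae_ge0_le_integral => //; [exact: measurable_powR_norm..|].
  apply: filterS fg => x fgx _; rewrite lee_fin ge0_ler_powR ?nnegrE//.
  by rewrite !ger0_norm ?Cabs_ge0.
Qed.

Lemma ess_bounded m : CLfun mu +oo%E m ->
  exists c : R, \forall x \ae mu, Cabs m x <= c.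
Proof.
move=> [_]; rewrite /CLnorm unlock /=; case: ifPn => [mu0 fin|].
  exists (fine (ess_sup mu (abse \o (EFin \o Cabs m)))).
  have := ess_sup_ge mu (abse \o (EFin \o Cabs m)).
  apply: filterS => x /= le.
  rewrite -lee_fin fineK.
    by apply: le_trans le; rewrite lee_fin ler_norm.
  by rewrite ge0_fin_numE ?fin// (le_trans _ le).
(* on a null space every bound holds almost everywhere *)
rewrite -leNgt measure_le0 => /eqP mu0 _; exists 0.
by apply: (@negligibleS _ _ _ mu setT) => //; apply/negligibleP.
Qed.

Variables (p : R) (p1 : (1 <= p%:E)%E).
Local Notation Lp := (Lp mu p1).

Lemma normc_real (c : R) : 0 <= c -> ComplexField.Normc.normc c%:C%C = c.
Proof. by move=> c0; rewrite /= expr0n/= addr0 sqrtr_sqr ger0_norm. Qed.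

Lemma Lp_norm_mul_le (f g : Lp) k (c : R) : 0 <= c ->
  (\forall x \ae mu, Cabs k x <= c) -> g = (fun x => k x * f x) %[ae mu] ->
  `|g| <= c%:C%C * `|f|.
Proof.
move=> c0 kc gkf; rewrite !Lp_normrE -rmorphM lecR -lee_fin EFinM.
rewrite -!/(Lp_norm _) !Lp_normE -[c in leRHS]normc_real// -CLnormZ//; last first.
  exact: Lp_funP.
have [mf _] := Lp_funP f; have [mg _] := Lp_funP g.
apply: CLnorm_le_ae => //.
  rewrite -[_ *: _]addr0; apply: Cmeasurable_lin => //.
  by case: (CLfun0 mu p1).
apply: filterS2 kc gkf => x kxc /(_ I) gx.
rewrite CabsZ normc_real//= /Cabs gx ComplexField.Normc.normcM.
by rewrite ler_wpM2r//; exact: (Cabs_ge0 f).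
Qed.

Lemma multiplier_exists k (c : R) : 0 <= c -> Cmeasurable k ->
    (forall x, Cabs k x <= c) ->
  exists2 M : Lp -> Lp, (forall f : Lp, `|M f| <= c%:C%C * `|f|) &
    forall f : Lp, Lp_fun (M f) = (fun x => k x * f x) %[ae mu].
Proof.
move=> c0 mk kc.
have kf_in (f : Lp) : (fun x => k x * f x) \in CLfun_pred mu p1.
  have [mf _] := Lp_funP f.
  (* c *: f dominates k * f; CLfun_lin asks for a second summand, here 0 *)
  have [mcf cf] := CLfun_lin p1 c%:C%C (Lp_funP f) (CLfun0 mu p1).
  rewrite inE; split; first exact: CmeasurableM.
  apply: le_lt_trans cf; apply: CLnorm_le_ae => //; first exact: CmeasurableM.
  apply: aeW => x; rewrite addr0 CabsZ normc_real//= /Cabs.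
  rewrite ComplexField.Normc.normcM.
  by rewrite ler_wpM2r ?(Cabs_ge0 f)//; exact: kc.
pose M (f : Lp) : Lp := \pi_Lp%qT (MkCLfun (kf_in f)).
have ME (f : Lp) : Lp_fun (M f) = (fun x => k x * f x) %[ae mu] by exact: Lp_repr.
by exists M => // f; apply: (@Lp_norm_mul_le _ _ k) => //; exact: aeW.
Qed.

Lemma multiplication_op_bounded (D : Lp -> Lp) :
  multiplication_op D -> bounded_op D.
Proof.
move=> [m /ess_bounded[c mc] DE]; exists (Num.max c 0) => f.
apply: (Lp_norm_mul_le _ _ (DE f)); first by rewrite le_max lexx orbT.
by apply: filterS mc => x mx; rewrite le_max mx.
Qed.

Lemma Lp_lincombE (a b : R[i]) (f g : Lp) :
  Lp_fun (a *: f + b *: g) = (fun x => a * f x + b * g x) %[ae mu].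
Proof.
apply: filterS3 (Lp_addE (a *: f) (b *: g)) (Lp_scaleE a f) (Lp_scaleE b g).
by move=> x fgx fx gx _; rewrite fgx// fx// gx.
Qed.

Lemma measurable_damping (t : R) :
  measurable_fun [set: R] (fun s : R => t / (1 + t ^+ 2 * s ^+ 2)).
Proof.
apply: continuous_measurable_fun => s.
apply: cvgM; first exact: cvg_cst.
apply: cvgV; first by rewrite gt_eqF// ltr_wpDr// mulr_ge0// sqr_ge0.
apply: cvgD; first exact: cvg_cst.
by apply: cvgM; [exact: cvg_cst | exact: exprn_continuous].
Qed.

Lemma mulcJ_Cabs f x : f x * (f x)^*%C = (Cabs f x ^+ 2)%:C%C.
Proof. by rewrite -sqr_normc CabsE rmorphXn. Qed.

(** The decomposition of the identity described at the top.  [E] is only known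
as the inverse of [D], not as a multiplication, so it is never evaluated
pointwise: writing [N = D H] with [H] the multiplication by [h] turns [E N]
and [N E] into [H]. *)
Lemma multiplication_op_splits (D E : {linear Lp -> Lp}) :
  multiplication_op D -> inverse_op D E -> splits_identity D E.
Proof.
move=> [m [mm _] DE] [_ DK EK] t t0.
pose h x : R := t / (1 + t ^+ 2 * Cabs m x ^+ 2).
have den0 x : 0 < 1 + t ^+ 2 * Cabs m x ^+ 2.
  by rewrite ltr_wpDr// mulr_ge0// sqr_ge0.
have h0 x : 0 <= h x by rewrite /h divr_ge0// ltW.
have ht x : h x <= t.
  rewrite /h ler_pdivrMr// ler_peMr ?(ltW t0)// lerDl.
  by rewrite mulr_ge0// sqr_ge0.
have hs x : h x * Cabs m x <= 2^-1.
  rewrite /h mulrAC ler_pdivrMr//.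
  (* 2 s <= 1 + s^2 for s = t |m x| *)
  by have := sqr_ge0 (t * Cabs m x - 1); rewrite sqrrB1 exprMn; lra.
have hsum x : t * (h x * Cabs m x ^+ 2) + t^-1 * h x = 1.
  by rewrite /h; field; rewrite exprMn (gt_eqF (den0 x)) (gt_eqF t0).
have mh : measurable_fun [set: T] h.
  exact: (measurableT_comp (measurable_damping t) (measurable_Cabs mm)).
have mhC := Cmeasurable_real mh.
have normch (z : R[i]) x : ComplexField.Normc.normc ((h x)%:C%C * z) =
    h x * ComplexField.Normc.normc z.
  by rewrite ComplexField.Normc.normcM normc_real.
have half0 : 0 <= 2^-1 :> R by rewrite invr_ge0.
have [M hM ME] : exists2 M : Lp -> Lp, half_contraction M &
    forall f : Lp,
      Lp_fun (M f) = (fun x => (h x)%:C%C * (m x)^*%C * f x) %[ae mu].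
  apply: multiplier_exists => //; first exact: CmeasurableM (Cmeasurable_conj mm).
  move=> x; move: (hs x); rewrite /Cabs normch.
  by case: (m x) => a b /=; rewrite sqrrN.
have [N hN NE] : exists2 N : Lp -> Lp, half_contraction N &
    forall f : Lp, Lp_fun (N f) = (fun x => (h x)%:C%C * m x * f x) %[ae mu].
  apply: multiplier_exists => //; first exact: CmeasurableM.
  by move=> x; rewrite /Cabs normch.
have [H _ HE] := @multiplier_exists _ t (ltW t0) mhC
  (fun x => ltac:(rewrite /Cabs normc_real//)).
have key (z : R[i]) x :
   t%:C%C * ((h x)%:C%C * (m x * (m x)^*%C) * z) +
   t^-1%:C%C * ((h x)%:C%C * z) = z.
  rewrite mulcJ_Cabs !mulrA -!rmorphM -mulrDl -rmorphD -[t * _ * _]mulrA/=.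
  by rewrite hsum mul1r.
have NDH (f : Lp) : N f = D (H f).
  apply: Lp_ext; apply: filterS3 (NE f) (DE (H f)) (HE f) => x Nx Dx Hx _.
  by rewrite Nx// Dx// Hx// mulrA [m x * _]mulrC.
have NEH (f : Lp) : N (E f) = H f.
  apply: Lp_ext; apply: filterS3 (NE (E f)) (DE (E f)) (HE f) => x Nx Dx Hx _.
  by rewrite Nx// Hx// -mulrA -Dx// EK.
have MDH (f : Lp) : f = t%:C%C *: M (D f) + t^-1%:C%C *: H f.
  apply: Lp_ext; apply: filterS2 (Lp_lincombE t%:C%C t^-1%:C%C (M (D f)) (H f))
    (filterI (ME (D f)) (filterI (DE f) (HE f))) => x eq_x [Mx [Dx Hx]] _.
  rewrite eq_x// Mx// Dx// Hx// -[LHS](key (f x) x); ring.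
have DMH (f : Lp) : f = t%:C%C *: D (M f) + t^-1%:C%C *: H f.
  apply: Lp_ext; apply: filterS2 (Lp_lincombE t%:C%C t^-1%:C%C (D (M f)) (H f))
    (filterI (DE (M f)) (filterI (ME f) (HE f))) => x eq_x [Dx [Mx Hx]] _.
  rewrite eq_x// Dx// Mx// Hx// -[LHS](key (f x) x); ring.
exists M, N; split => // f; first by rewrite NEH.
by rewrite NDH DK.
Qed.

End multiplication.

(** * The norm inequalities *)

Theorem corollary2p2 (d : measure_display) (T : measurableType d) (R : realType)
    (mu : {measure set T -> \bar R}) (mu_sigma_finite : sigma_finite [set: T] mu)
    (p : R) (p1 : (1 <= p%:E)%E)
    (D Dinv A : {linear Lp mu p1 -> Lp mu p1})
    (D_mult : multiplication_op D) (D_inv : inverse_op D Dinv)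
    (A_bounded : bounded_op A) :
  opnorm A ^+ 2 <= opnorm (D \o A) * opnorm (Dinv \o A) /\
  opnorm A ^+ 2 <= opnorm (A \o D) * opnorm (A \o Dinv).
Proof.
have [Dinv_bounded _ _] := D_inv.
apply: opnorm_sqr_le_comp => //; first exact: multiplication_op_bounded.
exact: multiplication_op_splits.
Qed.
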